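(* Let $k,l,n$ be three integers such that $k\geq 2$, $0\leq l\leq k-2$ and $n\geq 1$. The $(k,l)$-extended Motzkin paths of length $n$ with endpoint $(n,l)$ are in bijection with the proper $(k,l)$-threshold sequences of length $n$.
   Context: A $(k,l)$-extended Motzkin path of length $n$ is a path on the integral lattice $\mathbb{Z}\times\mathbb{Z}$ never going below the $x$-axis, starting in position $(0,0)$ and ending in position $(n,h)$ for some $0\leq h\leq l$, whose $n$ steps are of three types: up steps $(1,u)$ with $u\geq 1$ an integer, horizontal steps $(1,0)$, and down steps $(1,-t)$ with $1\leq t\leq k-1$ an integer. Here a step $(a,b)$ moves $a$ units to the right and $b$ units up from the current position. A $(k,l)$-threshold sequence of length $n$ is a strictly increasing sequence $S=(s_1s_2\ldots s_n)$ of integers such that $ki\leq s_i\leq kn+l$ for all $1\le i\le n$. It is proper if $s_n=kn+l$. *)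

(* Defs.v *)
From mathcomp Require Import all_boot all_order all_algebra.

Set Implicit Arguments.
Unset Strict Implicit.
Unset Printing Implicit Defensive.

Import Order.TTheory GRing.Theory Num.Theory.
Local Open Scope ring_scope.

Notation lattice_point := (int * int)%type.

Definition origin : lattice_point := (0, 0).

Definition up_step (v : lattice_point) : bool := (v.1 == 1) && (1 <= v.2).

Definition horizontal_step (v : lattice_point) : bool := v == (1, 0).

Definition down_step (k : int) (v : lattice_point) : bool :=
  (v.1 == 1) && (1 <= - v.2 <= k - 1).

Definition motzkin_step (k : int) (v : lattice_point) : bool :=
  [|| up_step v, horizontal_step v | down_step k v].

(* A path of length n is given by the tuple [p] of the n points visited after
   the origin. *)
Definition endpoint n (p : n.-tuple lattice_point) : lattice_point :=
  last origin p.

Definition is_ext_motzkin_path (k l : int) n (p : n.-tuple lattice_point) :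
    bool :=
  [&& path (fun x y => motzkin_step k (y - x)) origin p,
      all (fun x => 0 <= x.2) p,
      (endpoint p).1 == n%:Z
    & 0 <= (endpoint p).2 <= l].

(* The indices of the tuple start at 0, so that [tnth s i] is s_(i+1). *)
Definition is_threshold_seq (k l : int) n (s : n.-tuple int) : bool :=
  sorted (fun x y : int => x < y) s &&
  [forall i : 'I_n, k * i.+1%:Z <= tnth s i <= k * n%:Z + l].

(* The default value of [last] is irrelevant for n >= 1. *)
Definition is_proper_threshold_seq (k l : int) n (s : n.-tuple int) : bool :=
  is_threshold_seq k l s && (last 0 s == k * n%:Z + l).

Definition ext_motzkin_path_to (k l : int) (n : nat) (q : lattice_point) :
    Type :=
  {p : n.-tuple lattice_point | is_ext_motzkin_path k l p && (endpoint p == q)}.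

Definition proper_threshold_seq (k l : int) (n : nat) : Type :=
  {s : n.-tuple int | is_proper_threshold_seq k l s}.

(* Main.v *)
(** Shear the lattice: the linear form (x, y) |-> y + k x sends a step (1, b) to
    b + k, so "b >= - (k - 1)" becomes "the form strictly increases". Since the
    i-th point of a path has abscissa i, the path is recovered from the values
    s_i = h_i + k i, and "h_i >= 0" becomes "s_i >= k i". *)

Require Import Defs.
From mathcomp Require Import all_boot all_order all_algebra.
From mathcomp Require Import zify.

Set Implicit Arguments.
Unset Strict Implicit.

Import Order.TTheory GRing.Theory Num.Theory.
Local Open Scope ring_scope.

Definition shear (k : int) (v : lattice_point) : int := v.2 + k * v.1.

(** The origin is left out of the tuple, so index [i] stands for the point reached after [i.+1]
    steps. *)
Definition unshear (k : int) n (s : n.-tuple int) : n.-tuple lattice_point :=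
  [tuple of mkseq (fun i => (i.+1%:Z, nth 0 s i - k * i.+1%:Z)) n].

(** The three ranges of rises, [1 - k, -1], {0} and [1, oo), are adjacent and fill the half-line
    from 1 - k on. *)
Lemma motzkin_stepE (k : int) (v : lattice_point) :
  1 <= k -> motzkin_step k v = (v.1 == 1) && (1 - k <= v.2).
Proof.
move=> k_ge1; case: v => a b.
rewrite /motzkin_step /up_step /horizontal_step /down_step xpair_eqE /=.
by case: (a == 1) => //=; lia.
Qed.

(* Stating the differences coordinatewise keeps them syntactically in [int],
   which [lia] needs. *)
Lemma motzkin_step_subE (k : int) (x y : lattice_point) :
  1 <= k ->
  motzkin_step k (y - x) = (y.1 - x.1 == 1) && (1 - k <= y.2 - x.2).
Proof. exact: motzkin_stepE. Qed.

Lemma motzkin_step_ltr_shear (k : int) (x y : lattice_point) :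
  1 <= k -> motzkin_step k (y - x) -> shear k x < shear k y.
Proof.
move=> k_ge1; rewrite motzkin_step_subE // /shear => /andP[/eqP dx dy].
have -> : y.1 = x.1 + 1 by lia.
by rewrite mulrDr mulr1; lia.
Qed.

(** The starting point is arbitrary so that the induction can move it along the path. *)
Lemma motzkin_path_abscissa (k : int) (x : lattice_point) (p : seq lattice_point)
    (i : nat) :
  1 <= k -> path (fun u v => motzkin_step k (v - u)) x p -> (i < size p)%N ->
  (nth origin p i).1 = x.1 + i.+1%:Z.
Proof.
move=> k_ge1; elim: p x i => [|y p IHp] x i //= /andP[].
rewrite motzkin_step_subE // => /andP[/eqP dx _] path_p.
have -> : x.1 = y.1 - 1 by lia.
case: i => [|i] /= lt_i; first by lia.
by rewrite (IHp _ _ path_p lt_i); lia.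
Qed.

Lemma sorted_ltr_le_last (x : int) s i :
  sorted (fun u v : int => u < v) s -> (i < size s)%N -> nth x s i <= last x s.
Proof.
move=> sorted_s lt_i.
have sorted_le : sorted <=%O s by apply: sub_sorted sorted_s => u v /ltW.
rewrite -nth_last; apply: (sorted_leq_nth le_trans le_refl) => //.
- by rewrite inE; case: (size s) lt_i.
- by case: (size s) lt_i.
Qed.

(** An increasing sequence is dominated by its last entry, so the value of that entry yields all the
    upper bounds. *)
Lemma is_proper_threshold_seqE (k l : int) n (s : n.-tuple int) :
  is_proper_threshold_seq k l s =
  [&& sorted (fun x y : int => x < y) s,
      [forall i : 'I_n, k * i.+1%:Z <= tnth s i] & last 0 s == k * n%:Z + l].
Proof.
rewrite /is_proper_threshold_seq /is_threshold_seq -andbA.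
case sorted_s: (sorted _ s) => //=; case: eqP => [last_s|]; rewrite ?andbF //.
rewrite !andbT; apply: eq_forallb => i; rewrite -last_s (tnth_nth 0).
by rewrite sorted_ltr_le_last ?andbT ?size_tuple.
Qed.

Lemma shear_proper (k l : int) n (p : n.-tuple lattice_point) :
  1 <= k ->
  is_ext_motzkin_path k l p && (endpoint p == (n%:Z, l)) ->
  is_proper_threshold_seq k l (map_tuple (shear k) p).
Proof.
move=> k_ge1 /andP[/and4P[path_p /allP p_ge0 _ _] /eqP end_p].
rewrite is_proper_threshold_seqE; apply/and3P; split.
- rewrite /= sorted_map; apply: (path_sorted (x := origin)).
  apply: sub_path path_p => x y; exact: motzkin_step_ltr_shear.
- apply/forallP => i; rewrite tnth_map (tnth_nth origin) /shear.
  rewrite (motzkin_path_abscissa k_ge1 path_p) ?size_tuple //= add0r.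
  by rewrite lerDr p_ge0 // mem_nth ?size_tuple.
(* The shear sends [origin] to 0, so the default values of the two [last] correspond. *)
- have last_s : last 0 (map (shear k) p) = shear k (endpoint p).
    have shear0 : shear k origin = 0 by rewrite /shear mulr0 addr0.
    by rewrite -shear0 last_map.
  by rewrite /= last_s end_p /shear /= addrC.
Qed.

Lemma unshear_motzkin (k l : int) n (s : n.-tuple int) :
  1 <= k -> 0 <= l -> (0 < n)%N -> is_proper_threshold_seq k l s ->
  is_ext_motzkin_path k l (unshear k s) &&
    (endpoint (unshear k s) == (n%:Z, l)).
Proof.
move=> k_ge1 l_ge0 n_gt0; rewrite is_proper_threshold_seqE.
case/and3P=> sorted_s /forallP s_ge /eqP last_s.
have {}s_ge i : (i < n)%N -> k * i.+1%:Z <= nth 0 s i.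
  by move=> lt_i; have := s_ge (Ordinal lt_i); rewrite (tnth_nth 0).
have end_p : endpoint (unshear k s) = (n%:Z, l).
  (* As n > 0, the last point is a true entry, of height (kn + l) - kn = l. *)
  rewrite /endpoint -nth_last size_tuple nth_mkseq ?prednK //.
  by rewrite -[in n.-1](size_tuple s) nth_last last_s addrAC subrr add0r.
rewrite /is_ext_motzkin_path end_p !eqxx /= l_ge0 lexx !andbT.
apply/andP; split.
- apply/(pathP origin) => i; rewrite size_mkseq => lt_i.
  rewrite motzkin_step_subE // nth_mkseq //.
  case: i lt_i => [|i] lt_i /=.
    (* The first step leaves the origin, so no earlier entry is available for comparison: its rise
       s_1 - k is nonnegative by the lower bound on s_1, and 0 >= 1 - k. *)
    by rewrite subr0 (le_trans (y := 0)) ?subr_le0 ?subr_ge0 ?s_ge.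
  rewrite nth_mkseq ?(ltnW lt_i) //=.
  have lt_s : nth 0 s i < nth 0 s i.+1.
    by apply: (sortedP 0 sorted_s); rewrite size_tuple.
  have -> : i.+2%:Z = i.+1%:Z + 1 by rewrite -PoszD addn1.
  rewrite addrAC subrr add0r eqxx /= mulrDr mulr1.
  (* With the product [k * i.+1%:Z] abstracted as [c], the goal is linear: the rise is b - a - k,
     and b - a >= 1 over the integers. *)
  have step_ge (a b c : int) : a < b -> 1 - k <= b - (c + k) - (a - c) by lia.
  exact: step_ge.
- apply/allP => x /mapP[i]; rewrite mem_iota => /andP[_ lt_i] -> /=.
  by rewrite subr_ge0 s_ge.
Qed.

Lemma shearK (k l : int) n (p : n.-tuple lattice_point) :
  1 <= k -> is_ext_motzkin_path k l p ->
  unshear k (map_tuple (shear k) p) = p.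
Proof.
move=> k_ge1 /and4P[path_p _ _ _].
apply: val_inj; apply: (eq_from_nth (x0 := origin)).
  by rewrite size_mkseq size_tuple.
move=> i; rewrite size_mkseq => lt_i.
have lt_p : (i < size p)%N by rewrite size_tuple.
have := motzkin_path_abscissa k_ge1 path_p lt_p.
(* Replacing [i.+1] by the abscissa of the point makes the two multiples of k cancel. *)
rewrite nth_mkseq // (nth_map origin) // /shear add0r => <-.
by rewrite addrK -surjective_pairing.
Qed.

Lemma unshearK (k : int) n (s : n.-tuple int) :
  map_tuple (shear k) (unshear k s) = s.
Proof.
apply: val_inj; apply: (eq_from_nth (x0 := 0)).
  by rewrite size_map size_mkseq size_tuple.
move=> i; rewrite size_map size_mkseq => lt_i.
by rewrite (nth_map origin) ?size_mkseq // nth_mkseq // /shear /= subrK.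
Qed.

Theorem proposition5p1 (k l : int) (n : nat)
    (hk : 2 <= k) (hl : 0 <= l <= k - 2) (hn : (1 <= n)%N) :
  exists f : ext_motzkin_path_to k l n (n%:Z, l) -> proper_threshold_seq k l n,
    bijective f.
Proof.
have k_ge1 : 1 <= k by lia.
have /andP[l_ge0 _] := hl.
pose f (p : ext_motzkin_path_to k l n (n%:Z, l)) : proper_threshold_seq k l n :=
  exist (fun s : n.-tuple int => is_proper_threshold_seq k l s) _
    (shear_proper k_ge1 (svalP p)).
pose g (s : proper_threshold_seq k l n) : ext_motzkin_path_to k l n (n%:Z, l) :=
  exist (fun p : n.-tuple lattice_point =>
           is_ext_motzkin_path k l p && (endpoint p == (n%:Z, l))) _
    (unshear_motzkin k_ge1 l_ge0 hn (svalP s)).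
exists f; exists g => [p | s]; apply: val_inj => /=; last exact: unshearK.
by have /andP[path_p _] := svalP p; apply: shearK path_p.
Qed.
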